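(* Let $n,p\ge 1$, let $f_1,\dots,f_n:\mathbb{R}^p\to\mathbb{R}$ and mixing matrices $W,\tilde W\in\mathbb{R}^{n\times n}$ satisfy Assumptions 1, 2 and 3 listed in the context, and let $L_{\mathbf f}=\max_i L_{f_i}$. Let $\{\mathbf{x}^k\}_{k\ge0}$ be generated by EXTRA with step size $\alpha$ satisfying $0<\alpha<\frac{2\lambda_{\min}(\tilde W)}{L_{\mathbf f}}$ from an arbitrary starting point $\mathbf{x}^0\in\mathbb{R}^{n\times p}$, and let $U,\mathbf{q}^k,\mathbf{z}^k,G$ be as defined in the context. Then, as $k\to\infty$, the following rates hold: (1) Running-average progress: $\displaystyle\frac1k\sum_{t=1}^k\|\mathbf{z}^t-\mathbf{z}^{t+1}\|_G^2=O\left(\frac1k\right)$; (2) Running-best progress: $\displaystyle\min_{1\le t\le k}\left\{\|\mathbf{z}^t-\mathbf{z}^{t+1}\|_G^2\right\}=o\left(\frac1k\right)$; (3) Running-average optimality residuals: $\displaystyle\frac1k\sum_{t=1}^k\|U\mathbf{q}^t+\alpha\nabla\mathbf{f}(\mathbf{x}^t)\|_{\tilde W}^2=O\left(\frac1k\right)$ and $\displaystyle\frac1k\sum_{t=1}^k\|U\mathbf{x}^t\|_{\mathrm F}^2=O\left(\frac1k\right)$; (4) Running-best optimality residuals: $\displaystyle\min_{1\le t\le k}\left\{\|U\mathbf{q}^t+\alpha\nabla\mathbf{f}(\mathbf{x}^t)\|_{\tilde W}^2\right\}=o\left(\frac1k\right)$ and $\displaystyle\min_{1\le t\le k}\left\{\|U\mathbf{x}^t\|_{\mathrm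 F}^2\right\}=o\left(\frac1k\right)$.
   Context: Setting. Consider the problem $\min_{x\in\mathbb{R}^p}\bar f(x)=\frac1n\sum_{i=1}^n f_i(x)$. For $\mathbf{x}\in\mathbb{R}^{n\times p}$ with rows $x_{(1)}^{\mathrm T},\dots,x_{(n)}^{\mathrm T}$, put $\mathbf{f}(\mathbf{x})=\sum_{i=1}^n f_i(x_{(i)})$, and let $\nabla\mathbf{f}(\mathbf{x})\in\mathbb{R}^{n\times p}$ be the matrix whose $i$-th row is $\nabla f_i(x_{(i)})^{\mathrm T}$. $\mathbf{1}\in\mathbb{R}^n$ is the all-ones vector; $\succ,\succcurlyeq$ denote the Loewner order on symmetric matrices; $\lambda_{\min}$ is the smallest eigenvalue; $\|\cdot\|_{\mathrm F}$ is the Frobenius norm. Assumption 1 (mixing matrices). There is a connected undirected graph with vertex set $\{1,\dots,n\}$ and edge set $\mathcal{E}$, and $W=[w_{ij}]$, $\tilde W=[\tilde w_{ij}]$ satisfy: (1) if $i\ne j$ and $(i,j)\notin\mathcal{E}$ then $w_{ij}=\tilde w_{ij}=0$; (2) $W=W^{\mathrm T}$, $\tilde W=\tilde W^{\mathrm T}$; (3) $\mathrm{null}(W-\tilde W)=\mathrm{span}\{\mathbf{1}\}$ and $\mathrm{null}(I-\tilde W)\supseteq\mathrm{span}\{\mathbf{1}\}$; (4) $\tilde W\succ0$ and $\frac{I+W}{2}\succcurlyeq\tilde W\succcurlyeq W$. Assumption 2. Each $f_i:\mathbb{R}^p\to\mathbb{R}$ is convex and differentiable with $\|\nabla f_i(x_a)-\nabla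 f_i(x_b)\|_2\le L_{f_i}\|x_a-x_b\|_2$ for all $x_a,x_b\in\mathbb{R}^p$, where $L_{f_i}\ge0$ is a constant. Assumption 3. The problem $\min_x\bar f(x)$ has a nonempty set of optimal solutions. EXTRA. Given $\alpha>0$ and $\mathbf{x}^0\in\mathbb{R}^{n\times p}$: $\mathbf{x}^1=W\mathbf{x}^0-\alpha\nabla\mathbf{f}(\mathbf{x}^0)$, and for $k=0,1,\dots$, $\mathbf{x}^{k+2}=(I+W)\mathbf{x}^{k+1}-\tilde W\mathbf{x}^k-\alpha[\nabla\mathbf{f}(\mathbf{x}^{k+1})-\nabla\mathbf{f}(\mathbf{x}^k)]$. Auxiliary objects. $U=(\tilde W-W)^{1/2}$ is the symmetric positive semidefinite square root of $\tilde W-W$; $\mathbf{q}^k=\sum_{t=0}^kU\mathbf{x}^t$; $\mathbf{z}^k=\begin{pmatrix}\mathbf{q}^k\\ \mathbf{x}^k\end{pmatrix}\in\mathbb{R}^{2n\times p}$; $G=\begin{pmatrix}I&\mathbf{0}\\ \mathbf{0}&\tilde W\end{pmatrix}$. For symmetric positive semidefinite $M$, $\|A\|_M=\sqrt{\mathrm{trace}(A^{\mathrm T}MA)}$. Convention: if $L_{\mathbf f}=0$, the step size condition is read as $\alpha>0$. *)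

(* Defs.v *)
From HB Require Import structures.
From mathcomp Require Import all_boot all_order all_algebra.
From mathcomp Require Import all_classical all_reals all_analysis.

Set Implicit Arguments.
Unset Strict Implicit.
Unset Printing Implicit Defensive.

Import Order.TTheory GRing.Theory Num.Theory.
Import numFieldNormedType.Exports.

Local Open Scope classical_set_scope.
Local Open Scope ring_scope.

Section LinearAlgebra.
Context {R : realType}.

(* On row or column vectors this is the Euclidean norm; the library norm on
   matrices is the sup norm. *)
Definition frobenius_norm (m n : nat) (A : 'M[R]_(m, n)) : R :=
  Num.sqrt (\sum_i \sum_j A i j ^+ 2).

Definition weighted_norm (m p : nat) (M : 'M[R]_m) (A : 'M[R]_(m, p)) : R :=
  Num.sqrt (\tr (A^T *m M *m A)).

Definition symmetric_mx (m : nat) (A : 'M[R]_m) : Prop := A^T = A.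

(* The Loewner order A >= B is [psd (A - B)]. *)
Definition psd (m : nat) (A : 'M[R]_m) : Prop :=
  symmetric_mx A /\ forall v : 'cV[R]_m, 0 <= (v^T *m A *m v) 0 0.

Definition pd (m : nat) (A : 'M[R]_m) : Prop :=
  symmetric_mx A /\ forall v : 'cV[R]_m, v != 0 -> 0 < (v^T *m A *m v) 0 0.

(* Such a matrix exists and is unique when A is positive semidefinite. *)
Definition is_psd_sqrt (m : nat) (A S : 'M[R]_m) : Prop :=
  psd S /\ S *m S = A.

(* A symmetric matrix of positive size has a finite nonempty set of real
   eigenvalues, whose infimum is then its minimum. *)
Definition lambda_min (m : nat) (A : 'M[R]_m) : R :=
  inf [set a : R | eigenvalue A a].

Definition null_space (m : nat) (A : 'M[R]_m) : set 'cV[R]_m :=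
  [set v | A *m v = 0].

Definition span_ones (m : nat) : set 'cV[R]_m :=
  range (fun c : R => c *: const_mx 1).

End LinearAlgebra.

Arguments span_ones {R} m _.

Section Network.
Context {R : realType} {n : nat}.
Implicit Types W Wt : 'M[R]_n.

Definition connected_graph (e : rel 'I_n) : Prop :=
  symmetric e /\ forall i j, connect e i j.

Definition mixing_matrices W Wt : Prop :=
  exists e : rel 'I_n,
    [/\ connected_graph e,
        forall i j, i != j -> ~~ e i j -> W i j = 0 /\ Wt i j = 0,
        symmetric_mx W /\ symmetric_mx Wt,
        null_space (W - Wt) = span_ones n /\
          span_ones n `<=` null_space (1%:M - Wt) &
        [/\ pd Wt, psd (2^-1 *: (1%:M + W) - Wt) & psd (Wt - W)]].

End Network.

Section Objective.
Context {R : realType} {n p : nat}.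
Implicit Types (g : 'rV[R]_p -> R) (f : 'I_n -> 'rV[R]_p -> R).

Definition gradient g (x : 'rV[R]_p) : 'rV[R]_p :=
  \row_j 'D_(delta_mx 0 j) g x.

Definition convex_smooth g (L : R) : Prop :=
  [/\ convex_function [set: convex_lmodType 'rV[R]_p] g,
      forall x, differentiable g x,
      0 <= L &
      forall xa xb, frobenius_norm (gradient g xa - gradient g xb)
                    <= L * frobenius_norm (xa - xb)].

Definition average_objective f (x : 'rV[R]_p) : R :=
  n%:R^-1 * \sum_i f i x.

Definition has_minimizer g : Prop :=
  exists xs, forall x, g xs <= g x.

Definition stacked_gradient f (x : 'M[R]_(n, p)) : 'M[R]_(n, p) :=
  \matrix_i gradient (f i) (row i x).

Definition max_lipschitz (L : 'I_n -> R) : R := \big[Num.max/0]_i L i.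

Definition extra_iterates f (W Wt : 'M[R]_n) (alpha : R)
    (x : nat -> 'M[R]_(n, p)) : Prop :=
  x 1%N = W *m x 0%N - alpha *: stacked_gradient f (x 0%N) /\
  forall k : nat,
    x k.+2 = (1%:M + W) *m x k.+1 - Wt *m x k
             - alpha *: (stacked_gradient f (x k.+1) - stacked_gradient f (x k)).

Definition q_seq (U : 'M[R]_n) (x : nat -> 'M[R]_(n, p)) (k : nat) :
    'M[R]_(n, p) :=
  \sum_(t < k.+1) U *m x t.

Definition z_seq (U : 'M[R]_n) (x : nat -> 'M[R]_(n, p)) (k : nat) :
    'M[R]_(n + n, p) :=
  col_mx (q_seq U x k) (x k).

Definition G_mx (Wt : 'M[R]_n) : 'M[R]_(n + n) := block_mx 1%:M 0 0 Wt.

End Objective.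

Section Rates.
Context {R : realType}.
Implicit Types u : nat -> R.

Definition running_average u (k : nat) : R :=
  k%:R^-1 * \sum_(1 <= t < k.+1) u t.

(* The default value u 1 is itself in the range as soon as 1 <= k. *)
Definition running_best u (k : nat) : R :=
  \big[Num.min/u 1%N]_(1 <= t < k.+1) u t.

End Rates.

(* Main.v *)
Require Import Defs.
From HB Require Import structures.
From mathcomp Require Import all_boot all_order all_algebra.
From mathcomp Require Import all_classical all_reals all_analysis.
From mathcomp Require Import ring lra zify.
Import Order.TTheory GRing.Theory Num.Theory.
Import numFieldNormedType.Exports.
Local Open Scope classical_set_scope.
Local Open Scope ring_scope.
Set Implicit Arguments.
Unset Strict Implicit.
Unset Printing Implicit Defensive.

(** Summing the recursion of EXTRA gives x^(k+1) = Wt x^k - U q^k - alpha grad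
    f(x^k) ([extra_closed_form]). This is a primal-dual iteration for the
    optimality system U q + alpha grad f(x) = 0, U x = 0. The system has a
    solution (xs, qs) ([extra_fixed_point_exists]): all rows of xs are one
    minimizer of the average objective, the rows of grad f(xs) then sum to 0,
    and the range of the symmetric matrix U, whose kernel is spanned by the
    all-ones vector, contains every matrix with vanishing column sums.

    Everything rests on one Lyapunov inequality ([extra_energy_step]). Pairing
    the closed form, centred at the fixed point, with x^(k+1) - xs gives, for
    z = (q, x),
      |z^(k+1) - zs|_G^2 + |z^k - z^(k+1)|_G^2
        <= |z^k - zs|_G^2 + (alpha L / 2) |x^k - x^(k+1)|^2.
    The psd matrix (I + W)/2 - Wt contributes a term of the right sign, and the
    gradient is evaluated at x^k instead of x^(k+1): the defect is absorbed by
    cocoercivity of the gradient ([gradient_cocoercive]) at the cost of the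
    last term. As Wt >= lambda_min(Wt) I ([lambda_min_pd]), the step size
    condition makes that term a fraction strictly below 1 of
    |z^k - z^(k+1)|_G^2, and telescoping shows that the progress is summable
    ([progress_summable]).

    The other two residuals are dominated by consecutive progress terms. For
    consensus, U x^(k+1) = q^(k+1) - q^k. For stationarity,
    U q^k + alpha grad f(x^k) = (x^k - x^(k+1)) - (I - Wt) x^k, and I - Wt
    factors through U because it vanishes on the kernel of U
    ([stationarity_bounded]). A nonnegative summable sequence has averages
    O(1/k), and its running minimum is o(1/k) because at least k/2 terms beyond a
    fixed rank have a small sum ([rates_of_dominated]). *)

(** * The trace inner product *)

Section TraceInnerProduct.
Context {R : realType}.

Definition dot (m p : nat) (A B : 'M[R]_(m, p)) : R := \tr (A^T *m B).

Lemma dotE m p (A B : 'M[R]_(m, p)) : dot A B = \sum_i \sum_j A i j * B i j.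
Proof.
rewrite /dot /mxtrace exchange_big; apply: eq_bigr => j _.
by rewrite mxE; apply: eq_bigr => i _; rewrite mxE.
Qed.

Lemma dotC m p (A B : 'M[R]_(m, p)) : dot A B = dot B A.
Proof. by rewrite /dot -mxtrace_tr trmx_mul trmxK. Qed.

Lemma dotDr m p (A B C : 'M[R]_(m, p)) : dot A (B + C) = dot A B + dot A C.
Proof. by rewrite /dot mulmxDr mxtraceD. Qed.

Lemma dotZr m p a (A B : 'M[R]_(m, p)) : dot A (a *: B) = a * dot A B.
Proof. by rewrite /dot -scalemxAr mxtraceZ. Qed.

Lemma dotNr m p (A B : 'M[R]_(m, p)) : dot A (- B) = - dot A B.
Proof. by rewrite -scaleN1r dotZr mulN1r. Qed.

Lemma dot0r m p (A : 'M[R]_(m, p)) : dot A 0 = 0.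
Proof. by rewrite -(scale0r 0) dotZr mul0r. Qed.

Lemma dotDl m p (A B C : 'M[R]_(m, p)) : dot (A + B) C = dot A C + dot B C.
Proof. by rewrite !(dotC _ C) dotDr. Qed.

Lemma dotZl m p a (A B : 'M[R]_(m, p)) : dot (a *: A) B = a * dot A B.
Proof. by rewrite !(dotC _ B) dotZr. Qed.

Lemma dotNl m p (A B : 'M[R]_(m, p)) : dot (- A) B = - dot A B.
Proof. by rewrite !(dotC _ B) dotNr. Qed.

Lemma dot_sumr m p (I : finType) (A : 'M[R]_(m, p)) (F : I -> 'M[R]_(m, p)) :
  dot A (\sum_i F i) = \sum_i dot A (F i).
Proof. exact: (big_morph _ (dotDr A) (dot0r A)). Qed.

Definition dot_bilin := (@dotDl, @dotDr, @dotNl, @dotNr, @dotZl, @dotZr).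

Lemma dot_mulr m k p (A : 'M[R]_(m, p)) (M : 'M[R]_(m, k)) (B : 'M[R]_(k, p)) :
  dot A (M *m B) = dot (M^T *m A) B.
Proof. by rewrite /dot trmx_mul trmxK mulmxA. Qed.

Lemma dot_ge0 m p (A : 'M[R]_(m, p)) : 0 <= dot A A.
Proof.
rewrite dotE; apply: sumr_ge0 => i _; apply: sumr_ge0 => j _.
by rewrite -expr2 sqr_ge0.
Qed.

Lemma dot_eq0 m p (A : 'M[R]_(m, p)) : dot A A = 0 -> A = 0.
Proof.
have sq_ge0 i j : 0 <= A i j * A i j by rewrite -expr2 sqr_ge0.
rewrite dotE => /eqP; rewrite psumr_eq0 => [/allP A0|i _]; last first.
  exact: sumr_ge0.
apply/matrixP => i j; rewrite mxE; apply/eqP.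
have /implyP/(_ isT) := A0 i (mem_index_enum i).
rewrite psumr_eq0// => /allP/(_ j (mem_index_enum j))/implyP/(_ isT).
by rewrite mulf_eq0 orbb.
Qed.

(** The nonnegativity of |c A - B|^2, divided by c. *)
Lemma dot_young m p c (A B : 'M[R]_(m, p)) : 0 < c ->
  2 * dot A B <= c * dot A A + c^-1 * dot B B.
Proof.
move=> c0; have := dot_ge0 (c *: A - B).
rewrite !dot_bilin (dotC B A) => h.
by rewrite -(ler_pM2l c0) mulrDr mulVKf ?gt_eqF//; nra.
Qed.

Lemma dot_rows m p (A B : 'M[R]_(m, p)) :
  dot A B = \sum_i dot (row i A) (row i B).
Proof.
rewrite dotE; apply: eq_bigr => i _; rewrite dotE big_ord1.
by apply: eq_bigr => j _; rewrite !mxE.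
Qed.

Lemma dot_cols m p (A B : 'M[R]_(m, p)) :
  dot A B = \sum_j dot (col j A) (col j B).
Proof.
rewrite dotE exchange_big; apply: eq_bigr => j _; rewrite dotE.
by apply: eq_bigr => i _; rewrite big_ord1 !mxE.
Qed.

Lemma dot_col_mx m1 m2 p (A1 B1 : 'M[R]_(m1, p)) (A2 B2 : 'M[R]_(m2, p)) :
  dot (col_mx A1 A2) (col_mx B1 B2) = dot A1 B1 + dot A2 B2.
Proof. by rewrite /dot tr_col_mx mul_row_col mxtraceD. Qed.

Lemma frobenius_norm_sqr m p (A : 'M[R]_(m, p)) :
  frobenius_norm A ^+ 2 = dot A A.
Proof.
have -> : frobenius_norm A = Num.sqrt (dot A A) by rewrite dotE.
by rewrite sqr_sqrtr ?dot_ge0.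
Qed.

Lemma psd_dot_ge0 m p (M : 'M[R]_m) (A : 'M[R]_(m, p)) :
  psd M -> 0 <= dot A (M *m A).
Proof.
move=> [_ Mpsd]; rewrite dot_cols; apply: sumr_ge0 => j _.
have -> : col j (M *m A) = M *m col j A by rewrite !colE mulmxA.
by rewrite /dot trace_mx11 mulmxA.
Qed.

Lemma weighted_norm_sqr m p (M : 'M[R]_m) (A : 'M[R]_(m, p)) :
  psd M -> weighted_norm M A ^+ 2 = dot A (M *m A).
Proof.
move=> Mpsd; have := psd_dot_ge0 A Mpsd.
by rewrite /weighted_norm /dot mulmxA => /sqr_sqrtr.
Qed.

Lemma psd_dot_sym m p (M : 'M[R]_m) (A B : 'M[R]_(m, p)) :
  symmetric_mx M -> dot A (M *m B) = dot B (M *m A).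
Proof. by move=> Ms; rewrite dot_mulr Ms dotC. Qed.

Lemma pd_psd m (M : 'M[R]_m) : pd M -> psd M.
Proof.
move=> [Ms Mpd]; split=> // v; have [->|/Mpd/ltW//] := eqVneq v 0.
by rewrite mulmx0 mxE.
Qed.

(** The constant is a sum of absolute values of entries rather than an operator
    norm: all that matters below is that some constant exists which serves
    matrices with any number of columns. *)
Lemma dot_quad_bounded m (M : 'M[R]_m) :
  exists2 K, 0 < K & forall p (A : 'M[R]_(m, p)), dot A (M *m A) <= K * dot A A.
Proof.
exists (1 + \sum_i \sum_k `|M i k|) => [|p A].
  by rewrite ltr_pwDl// sumr_ge0// => i _; rewrite sumr_ge0.
rewrite mulrDl mul1r -[leLHS]add0r lerD ?dot_ge0//.
have -> : dot A (M *m A) =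
    \sum_i \sum_k M i k * dot (row i A) (row k A).
  rewrite dot_rows; apply: eq_bigr => i _; rewrite row_mul mulmx_sum_row dot_sumr.
  by apply: eq_bigr => k _; rewrite dotZr mxE.
rewrite mulr_suml ler_sum// => i _; rewrite mulr_suml ler_sum// => k _.
(* Each |<a, b>| is at most (|a|^2 + |b|^2) / 2, for rows a and b of A. *)
have row_le l : dot (row l A) (row l A) <= dot A A.
  by rewrite (dot_rows A) (bigD1 l)//= lerDl sumr_ge0// => ? _; exact: dot_ge0.
have := row_le i; have := row_le k.
have := dot_ge0 (row i A - row k A); have := dot_ge0 (row i A + row k A).
rewrite !dot_bilin (dotC (row k A)) => h1 h2 h3 h4.
apply: le_trans (ler_norm _) _; rewrite normrM ler_wpM2l// ler_norml.
by apply/andP; split; lra.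
Qed.

Lemma dot_mulmx_bounded m k (C : 'M[R]_(k, m)) : exists2 K, 0 < K &
  forall p (A : 'M[R]_(m, p)), dot (C *m A) (C *m A) <= K * dot A A.
Proof.
have [K K0 hK] := dot_quad_bounded (C^T *m C); exists K => // p A.
by rewrite dot_mulr mulmxA dotC.
Qed.

End TraceInnerProduct.

(** * Definite matrices and the smallest eigenvalue *)

Section Positivity.
Context {R : realType}.

Lemma form_dot m (M : 'M[R]_m) (v : 'cV[R]_m) : (v^T *m M *m v) 0 0 = dot v (M *m v).
Proof. by rewrite /dot trace_mx11 mulmxA. Qed.

Lemma psd_subr_scalar m (A : 'M[R]_m) t : symmetric_mx A ->
  psd (A - t%:M) <-> forall v : 'cV[R]_m, t * dot v v <= dot v (A *m v).
Proof.
move=> As; have E (v : 'cV[R]_m) : (v^T *m (A - t%:M) *m v) 0 0 = dot v (A *m v) - t * dot v v.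
  by rewrite form_dot mulmxBl mul_scalar_mx !dot_bilin.
split=> [[_ h] v|h]; first by have := h v; rewrite E subr_ge0.
split=> [|v]; last by rewrite E subr_ge0.
by rewrite /symmetric_mx linearB /= As tr_scalar_mx.
Qed.

Lemma psd_subr_scalar_dot m p (A : 'M[R]_m) t (B : 'M[R]_(m, p)) :
  psd (A - t%:M) -> t * dot B B <= dot B (A *m B).
Proof.
move=> /(psd_dot_ge0 B).
by rewrite mulmxBl mul_scalar_mx dotDr dotNr dotZr subr_ge0.
Qed.

(** Let w = M v. Moving from v by - w / K changes the form by - 2 |w|^2 / K to
    first order, and the second order gives back at most |w|^2 / K. Starting
    from the value 0, the form would become negative unless w = 0. *)
Lemma psd_form0 m (M : 'M[R]_m) (v : 'cV[R]_m) :
  psd M -> dot v (M *m v) = 0 -> M *m v = 0.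
Proof.
move=> Mpsd v0; apply: dot_eq0; set w := M *m v.
have Ms : symmetric_mx M by case: Mpsd.
have [K K0 /(_ _ w) hK] := dot_quad_bounded M.
have := psd_dot_ge0 (v - K^-1 *: w) Mpsd.
rewrite mulmxBr -scalemxAr !dot_bilin v0 (psd_dot_sym w v Ms) -/w.
rewrite (psd_dot_sym v w Ms) -/w => h.
have ww := dot_ge0 w; apply/le_anti; rewrite ww andbT.
have : K * (0 - K^-1 * dot w w + - (K^-1 * (dot w w - K^-1 * dot w (M *m w)))) >= 0.
  by apply: mulr_ge0; [exact: ltW|]; lra.
rewrite [X in 0 <= X -> _](_ : _ = - 2 * dot w w + K^-1 * dot w (M *m w)); last first.
  by field; rewrite gt_eqF.
have : K^-1 * dot w (M *m w) <= dot w w by rewrite ler_pdivrMl.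
lra.
Qed.

(** With K a bound for the form of the inverse of M, nonnegativity of the form
    of M at v - K^-1 M^-1 v yields the bound with c = K^-1. *)
Lemma pd_coercive m (M : 'M[R]_m) : pd M ->
  exists2 c, 0 < c & forall v : 'cV[R]_m, c * dot v v <= dot v (M *m v).
Proof.
move=> Mpd; have Mpsd := pd_psd Mpd; have Ms : symmetric_mx M by case: Mpsd.
have Munit : M \in unitmx.
  rewrite -row_free_unit -kermx_eq0; apply/eqP/row_matrixP => i.
  apply: trmx_inj; set v := (row i _)^T.
  have Mv : M *m v = 0.
    by rewrite -Ms -trmx_mul -row_mul mulmx_ker row0 trmx0.
  rewrite row0 trmx0; apply/eqP/negPn/negP => v0; case: Mpd => _ /(_ _ v0).
  by rewrite form_dot Mv dot0r ltxx.
have [K K0 hK] := dot_quad_bounded (invmx M).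
exists K^-1 => [|v]; first by rewrite invr_gt0.
have := psd_dot_ge0 (v - K^-1 *: (invmx M *m v)) Mpsd; have := hK _ v.
rewrite mulmxBr -scalemxAr mulmxA mulmxV// mul1mx !dot_bilin.
rewrite (dotC (invmx M *m v) v) (dotC (invmx M *m v) (M *m v)) (dotC (M *m v)).
rewrite (psd_dot_sym _ v Ms) mulmxA mulmxV// mul1mx.
set a := dot v v; set b := dot v (invmx M *m v); set c := dot v (M *m v) => ba h.
have : K^-1 * (K^-1 * b) <= K^-1 * a by rewrite ler_pM2l ?invr_gt0// ler_pdivrMl.
lra.
Qed.

(** The supremum s of the t with A >= t I is an eigenvalue: A - s I is psd, and
    were its kernel trivial it would be positive definite, hence coercive, and
    s could be increased. It is a lower bound of the spectrum because an
    eigenvector turns A >= s I into an inequality between eigenvalues. *)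
Lemma lambda_min_pd m (A : 'M[R]_m) : (0 < m)%N -> pd A ->
  0 < lambda_min A /\ psd (A - (lambda_min A)%:M).
Proof.
move=> m0 Apd; have [As _] := Apd.
pose S := [set t : R | forall v : 'cV[R]_m, t * dot v v <= dot v (A *m v)].
have [c c0 Sc] := pd_coercive Apd.
have [K K0 hK] := dot_quad_bounded A.
pose e : 'cV[R]_m := const_mx 1.
have e0 : 0 < dot e e.
  rewrite lt_neqAle dot_ge0 andbT eq_sym; apply/eqP => /dot_eq0/matrixP.
  by move=> /(_ (Ordinal m0) 0)/eqP; rewrite !mxE oner_eq0.
have Sub : has_ubound S.
  by exists K => t /(_ e) h; rewrite -(ler_pM2r e0) (le_trans h).
have Ssup : has_sup S by split=> //; exists c.
have supS : S (sup S).
  move=> v; have := dot_ge0 v; rewrite le0r => /predU1P[/[dup] v0 ->|v0].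
    by rewrite mulr0 (dot_eq0 v0) mulmx0 dot0r.
  rewrite -ler_pdivlMr// ge_sup//; first by exists c.
  by move=> t /(_ v); rewrite ler_pdivlMr.
have s0 : 0 < sup S by rewrite (lt_le_trans c0)// ub_le_sup.
have Bpsd : psd (A - (sup S)%:M) by apply/psd_subr_scalar.
have [Bs Bge0] := Bpsd.
have [v v0 Bv] : exists2 v : 'cV[R]_m, v != 0 & (A - (sup S)%:M) *m v = 0.
  apply: contrapT => noker; have Bpd : pd (A - (sup S)%:M).
    split=> // v v0; rewrite lt_neqAle Bge0 andbT; apply/eqP => /esym.
    by rewrite form_dot => /(psd_form0 Bpsd) Bv; apply: noker; exists v.
  have [d d0 Sd] := pd_coercive Bpd.
  have : S (sup S + d).
    move=> v; have := Sd v; rewrite mulmxBl mul_scalar_mx !dot_bilin mulrDl.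
    by rewrite lerBrDl.
  by move/(ub_le_sup Sub); rewrite gerDl leNgt d0.
have eig : [set a : R | eigenvalue A a] (sup S).
  apply/eigenvalueP; exists v^T; last by rewrite trmx_eq0.
  by rewrite -{1}As -trmx_mul -linearZ /=; congr _^T; apply/eqP;
    rewrite -subr_eq0 -mul_scalar_mx -mulmxBl Bv.
have lbE : lbound [set a : R | eigenvalue A a] (sup S).
  move=> a /= /eigenvalueP[w wA w0].
  have w0' : 0 < dot w^T w^T.
    rewrite lt_neqAle dot_ge0 andbT eq_sym; apply/eqP => /dot_eq0/eqP.
    by rewrite trmx_eq0 (negbTE w0).
  have := supS w^T; rewrite -{1}As -trmx_mul wA linearZ /= dotZr.
  by rewrite ler_pM2r.
have -> : lambda_min A = sup S; last by [].
apply/le_anti/andP; split; first by apply: ge_inf => //; exists (sup S).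
by apply: lb_le_inf => //; exists (sup S).
Qed.

(** The hypothesis says that M annihilates the columns of the cokernel matrix
    of U, which is the criterion for the rows of M to lie in the row space of
    U. *)
Lemma factor_null_space k m n (M : 'M[R]_(k, n)) (U : 'M[R]_(m, n)) :
  (forall v : 'cV[R]_n, U *m v = 0 -> M *m v = 0) -> exists C, M = C *m U.
Proof.
move=> nullUM; have : (M <= U)%MS; last by case/submxP => C; exists C.
have colM l (N : 'M[R]_(l, n)) j : N *m col j (cokermx U) = col j (N *m cokermx U).
  by rewrite !colE mulmxA.
rewrite submxE; apply/eqP/matrixP => i j; rewrite mxE.
have /(congr1 (fun c : 'cV_k => c i 0)) : M *m col j (cokermx U) = 0.
  by apply: nullUM; rewrite colM mulmx_coker; apply/colP => l; rewrite !mxE.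
by rewrite colM !mxE.
Qed.

End Positivity.

(** * Smooth convex functions *)

Section SmoothConvex.
Context {R : realType} {p : nat}.
Implicit Types (g : 'rV[R]_p -> R) (x y d : 'rV[R]_p).

Lemma derive_gradient g x d :
  differentiable g x -> 'D_d g x = dot (gradient g x) d.
Proof.
move=> dg; rewrite deriveE// {1}[d]row_sum_delta linear_sum dotE big_ord1.
by apply: eq_bigr => j _; rewrite linearZ /= -deriveE// !mxE mulrC.
Qed.

Lemma is_derive_along_line g x d (t : R) : (forall y, differentiable g y) ->
  is_derive t 1 (fun s => g (x + s *: d)) (dot (gradient g (x + t *: d)) d).
Proof.
move=> dg; rewrite -derive_gradient//.
have E : (fun s : R => s^-1 *: (((fun s => g (x + s *: d)) \o shift t) (s *: 1)
             - g (x + t *: d))) =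
         (fun s : R => s^-1 *: ((g \o shift (x + t *: d)) (s *: d)
             - g (x + t *: d))).
  apply: funext => s /=; congr (_ *: (g _ - _)).
  by rewrite [s *: 1]mulr1 scalerDl addrCA.
have := @diff_derivable _ _ _ g (x + t *: d) d (dg _).
by split; [rewrite /derivable E|rewrite /derive E].
Qed.

Lemma convex_smooth_le g L L' : L <= L' -> convex_smooth g L ->
  convex_smooth g L'.
Proof.
move=> LL' [gc gd L0 gL]; split=> //; first exact: le_trans LL'.
by move=> xa xb; rewrite (le_trans (gL _ _))// ler_wpM2r// sqrtr_ge0.
Qed.

Lemma gradient_lipschitz_sqr g L x y : convex_smooth g L ->
  dot (gradient g x - gradient g y) (gradient g x - gradient g y)
    <= L ^+ 2 * dot (x - y) (x - y).
Proof.
move=> [_ _ L0 /(_ x y) gL]; rewrite -!frobenius_norm_sqr -exprMn.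
by rewrite lerXn2r// nnegrE ?mulr_ge0// sqrtr_ge0.
Qed.

(** For 0 < s <= 1 convexity bounds the difference quotient of g at x in the
    direction y - x by g y - g x; let s tend to 0 from the right. *)
Lemma convex_gradient_le g L x y : convex_smooth g L ->
  g x + dot (gradient g x) (y - x) <= g y.
Proof.
move=> [gc gd _ _]; rewrite addrC -lerBrDr -derive_gradient//.
apply: (cvgr_to_le (cvg_dnbhs_at_right (diff_derivable (gd x)))).
near=> s; have s0 : 0 < s by [].
have s1 : s <= 1 by near: s; exact: nbhs_right_le.
have := gc (Itv01 (ltW s0) s1) y x; rewrite !in_setE => /(_ I I).
rewrite /= ler_pdivrMl//.
have -> : conv (Itv01 (ltW s0) s1) (y : convex_lmodType 'rV[R]_p) x
    = s *: y + (1 - s) *: x by [].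
have -> : conv (Itv01 (ltW s0) s1) (g y : R^o) (g x)
    = s * g y + (1 - s) * g x by [].
have -> : s *: (y - x) + x = s *: y + (1 - s) *: x.
  by rewrite scalerBr scalerBl scale1r -addrA; congr (_ + _); rewrite addrC.
lra.
Unshelve. all: by end_near.
Qed.

(** Along the segment from x to x + d, the difference phi between g and its
    quadratic model has a nonpositive derivative, by Lipschitz continuity of
    the gradient; the mean value theorem applied to phi concludes. *)
Lemma descent_le g L x d : 0 < L -> convex_smooth g L ->
  g (x + d) <= g x + dot (gradient g x) d + L / 2 * dot d d.
Proof.
move=> L0 gs; have [gc gd _ _] := gs.
pose phi (t : R) := g (x + t *: d) - t * dot (gradient g x) d
  - L / 2 * dot d d * t ^+ 2.
pose dphi (t : R) := dot (gradient g (x + t *: d)) d - dot (gradient g x) d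
  - L * dot d d * t.
have phiD (t : R) : is_derive t 1 phi (dphi t).
  have hD := @is_derive_along_line g x d t gd.
  have aD : is_derive t (1 : R) (fun s : R => s * dot (gradient g x) d) (dot (gradient g x) d).
    by apply: is_derive_eq; rewrite /GRing.scale /= mulr0 add0r mulr1.
  have sD : is_derive t (1 : R) (fun s : R => L / 2 * dot d d * s ^+ 2) (L * dot d d * t).
    by apply: is_derive_eq; rewrite /GRing.scale /=; field.
  exact: (is_deriveB (is_deriveB hD aD) sD).
have phiC : {within `[0, 1], continuous phi}.
  by apply: derivable_within_continuous => t _; have [] := phiD t.
have [c /[!in_itv]/= /andP[c0 _]] := MVT ltr01 (fun t _ => phiD t) phiC.
rewrite subr0 mulr1 => E.
have dphi_le0 : dphi c <= 0.
  rewrite /dphi; have Lc0 : 0 < L * c by rewrite mulr_gt0.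
  have Lc0' : 0 < (L * c)^-1 by rewrite invr_gt0.
  (* The weight 1 / (L c) balances the two terms: both become L c |d|^2. *)
  have := dot_young (gradient g (x + c *: d) - gradient g x) d Lc0'.
  have := gradient_lipschitz_sqr (x + c *: d) x gs.
  rewrite (addrAC x) subrr add0r -(ler_pM2l Lc0') => h1.
  have -> : dot (gradient g (x + c *: d)) d - dot (gradient g x) d
    = dot (gradient g (x + c *: d) - gradient g x) d by rewrite !dot_bilin.
  move=> h2; have := le_trans h2 (lerD h1 (lexx _)).
  rewrite invrK (dotZl c) (dotZr c).
  have -> : (L * c)^-1 * (L ^+ 2 * (c * (c * dot d d))) = L * c * dot d d.
    by field; rewrite !gt_eqF.
  lra.
move: dphi_le0; rewrite -E /phi scale1r scale0r addr0; lra.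
Qed.

(** Compare g at the point y - h / L, with h the difference of the gradients:
    the tangent at x bounds it from below, and a gradient step from y for the
    convex function g - <grad g(x), .> bounds it from above. *)
Lemma bregman_lower_bound g L x y : 0 < L -> convex_smooth g L ->
  g x + dot (gradient g x) (y - x)
    + (2 * L)^-1 * dot (gradient g y - gradient g x) (gradient g y - gradient g x)
  <= g y.
Proof.
move=> L0 gs; have [h hE] : {h | h = gradient g y - gradient g x} by eexists.
rewrite -hE.
have := descent_le y (- L^-1 *: h) L0 gs.
have := convex_gradient_le x (y + - L^-1 *: h) gs.
rewrite (addrAC y) !dot_bilin.
have -> : L / 2 * (- L^-1 * (- L^-1 * dot h h)) = (2 * L)^-1 * dot h h.
  by field; rewrite gt_eqF.
have hh : dot h h = dot (gradient g y) h - dot (gradient g x) h.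
  by rewrite {1}hE dotDl dotNl.
have : L^-1 * dot h h = 2 * ((2 * L)^-1 * dot h h) by field; rewrite gt_eqF.
rewrite {1}hh; lra.
Qed.

(** The Baillon-Haddad inequality: add the preceding bound to the one with x
    and y exchanged. *)
Lemma gradient_cocoercive g L x y : 0 < L -> convex_smooth g L ->
  L^-1 * dot (gradient g x - gradient g y) (gradient g x - gradient g y)
  <= dot (x - y) (gradient g x - gradient g y).
Proof.
move=> L0 gs.
have := bregman_lower_bound x y L0 gs; have := bregman_lower_bound y x L0 gs.
have -> : dot (x - y) (gradient g x - gradient g y)
    = - dot (gradient g y) (x - y) - dot (gradient g x) (y - x).
  by rewrite -(opprB x y) !dotNr (dotC (x - y)) dotDl dotNl opprK addrC.
have -> : dot (gradient g y - gradient g x) (gradient g y - gradient g x)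
    = dot (gradient g x - gradient g y) (gradient g x - gradient g y).
  by rewrite -(opprB (gradient g x)) dotNl dotNr opprK.
rewrite invfM; lra.
Qed.

End SmoothConvex.

(** * Rates of nonnegative summable sequences *)

Section Rates.
Context {R : realType}.
Implicit Types u P : nat -> R.

Lemma running_average_bigO u M : (forall t, 0 <= u t) ->
  (forall k, \sum_(1 <= t < k.+1) u t <= M) ->
  running_average u =O_\oo (fun k : nat => (k%:R^-1 : R)).
Proof.
move=> u0 uM; have sum_ge0 k : 0 <= \sum_(1 <= t < k.+1) u t by exact: sumr_ge0.
apply/eqO_exP; exists (M + 1); first by rewrite ltr_wpDl// (le_trans _ (uM 0%N)).
near=> k; rewrite /running_average normrM mulrC ler_wpM2r//.
by rewrite ger0_norm// (le_trans (uM k))// lerDl.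
Unshelve. all: by end_near.
Qed.

(** Past a rank N the partial sums S are within eps / 2 of their supremum. Then
    (k - N) times the minimum over t <= k is at most S k - S N <= eps / 2, and
    k <= 2 (k - N) as soon as k >= 2 N. *)
Lemma running_best_littleo u M : (forall t, 0 <= u t) ->
  (forall k, \sum_(1 <= t < k.+1) u t <= M) ->
  running_best u =o_\oo (fun k : nat => (k%:R^-1 : R)).
Proof.
move=> u0 uM; set S := fun k => \sum_(1 <= t < k.+1) u t.
have Ssup : has_sup (range S).
  by split; [exists (S 0%N), 0%N|exists M => _ [k _ <-]; exact: uM].
have best_ge0 k : 0 <= running_best u k.
  by rewrite /running_best; elim/big_ind: _ => // a b a0 b0; rewrite le_min a0.
apply/eqoP => eps eps0.
have e2 : 0 < eps / 2 by rewrite divr_gt0.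
have [_ [N _ <-] SN] := sup_adherent e2 Ssup.
near=> k; have kN : (N.*2.+1 <= k)%N by near: k; exact: nbhs_infty_ge.
have Nk : (N <= k)%N by rewrite (leq_trans _ kN)// -addnn leqW// leq_addr.
have k0 : 0 < k%:R :> R by rewrite ltr0n (leq_trans _ kN).
rewrite !ger0_norm// ?invr_ge0//.
rewrite ler_pdivlMr//.
have tail : (k - N)%:R * running_best u k <= S k - S N.
  have -> : S k - S N = \sum_(N.+1 <= t < k.+1) u t.
    by rewrite /S (@big_cat_nat _ _ _ N.+1)//= addrAC subrr add0r.
  rewrite -(subSS N k).
  have -> : (k.+1 - N.+1)%:R * running_best u k
      = \sum_(N.+1 <= t < k.+1) running_best u k.
    by rewrite sumr_const_nat mulr_natl.
  rewrite big_nat [leRHS]big_nat; apply: ler_sum => t /andP[Nt tk].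
  by apply: ge_bigmin_seq => //; rewrite mem_index_iota (leq_trans _ Nt).
have Sk : S k <= sup (range S) by apply: ub_le_sup; [case: Ssup|exists k].
have half : k%:R <= 2 * (k - N)%:R :> R.
  rewrite -natrM ler_nat; move: kN; rewrite -mul2n; clear; lia.
have : running_best u k * k%:R <= running_best u k * (2 * (k - N)%:R).
  exact: ler_wpM2l.
lra.
Unshelve. all: by end_near.
Qed.

(** The residual at t.+1 is compared with the progress at both t and t.+1, as
    consensus is controlled by the former and stationarity by both. *)
Lemma rates_of_dominated u P K M :
  (forall t, 0 <= P t) -> (forall k, \sum_(0 <= t < k) P t <= M) -> 0 <= K ->
  (forall t, 0 <= u t) -> (forall t, u t.+1 <= K * (P t + P t.+1)) ->
  running_average u =O_\oo (fun k : nat => (k%:R^-1 : R)) /\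
  running_best u =o_\oo (fun k : nat => (k%:R^-1 : R)).
Proof.
move=> P0 PM K0 u0 uP.
have uM k : \sum_(1 <= t < k.+1) u t <= K * (M + M).
  rewrite big_add1 /= (le_trans (ler_sum _ (fun t _ => uP t)))//.
  rewrite -mulr_sumr ler_wpM2l// big_split lerD//=.
  by rewrite (le_trans _ (PM k.+1))// [leRHS]big_nat_recl// lerDr.
by split; [exact: running_average_bigO uM|exact: running_best_littleo uM].
Qed.

End Rates.

(** * The EXTRA iteration *)

Section Extra.
Context {R : realType} {n p : nat}.
Implicit Types (W Wt U : 'M[R]_n) (f : 'I_n -> 'rV[R]_p -> R)
  (x : nat -> 'M[R]_(n, p)).

Lemma q_seqS U x k : q_seq U x k.+1 = q_seq U x k + U *m x k.+1.
Proof. by rewrite /q_seq big_ord_recr. Qed.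

(** The increment x^(k+2) - x^(k+1) of the recursion is the increment of the
    right-hand side, since U (q^(k+1) - q^k) = U U x^(k+1) = (Wt - W) x^(k+1). *)
Lemma extra_closed_form f W Wt U alpha x k :
  U *m U = Wt - W -> extra_iterates f W Wt alpha x ->
  x k.+1 = Wt *m x k - U *m q_seq U x k - alpha *: stacked_gradient f (x k).
Proof.
move=> UU [x1 xS]; elim: k => [|k IH].
  by rewrite /q_seq big_ord1 mulmxA UU mulmxBl x1 subKr.
rewrite xS q_seqS mulmxDr mulmxA UU mulmxBl mulmxDl mul1mx scalerBr.
have -> : U *m q_seq U x k
    = Wt *m x k - alpha *: stacked_gradient f (x k) - x k.+1.
  rewrite IH; move: (U *m _) (Wt *m _) (alpha *: _) => a b c.
  by apply/matrixP => i j; rewrite !mxE; ring.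
move: (W *m _) (Wt *m x k) (Wt *m x k.+1) (stacked_gradient f (x k.+1))
  (stacked_gradient f (x k)).
by move=> a b c d e; apply/matrixP => i j; rewrite !mxE; ring.
Qed.

Lemma psd_G_mx Wt : psd Wt -> psd (G_mx Wt).
Proof.
move=> Wtpsd; have [Wts _] := Wtpsd; split=> [|v].
  by rewrite /symmetric_mx /G_mx tr_block_mx trmx1 !trmx0 Wts.
rewrite form_dot -[v]vsubmxK /G_mx mul_block_col !mul0mx mul1mx add0r addr0.
by rewrite dot_col_mx addr_ge0 ?dot_ge0// psd_dot_ge0.
Qed.

Lemma progressE Wt U x t : psd Wt ->
  weighted_norm (G_mx Wt) (z_seq U x t - z_seq U x t.+1) ^+ 2 =
  dot (U *m x t.+1) (U *m x t.+1)
    + dot (x t - x t.+1) (Wt *m (x t - x t.+1)).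
Proof.
move=> Wtpsd; rewrite weighted_norm_sqr; last exact: psd_G_mx.
rewrite /z_seq opp_col_mx add_col_mx q_seqS opprD addNKr.
rewrite /G_mx mul_block_col !mul0mx mul1mx add0r addr0 dot_col_mx.
by rewrite dotNl dotNr opprK.
Qed.

(** The descent inequality also serves as first-order condition: a step of
    length c = 1 / (n L) against the sum g of the gradients would decrease the
    objective by a multiple of |g|^2. *)
Lemma sum_gradient_at_minimizer f L xs : (0 < n)%N -> 0 < L ->
  (forall i, convex_smooth (f i) L) ->
  (forall y, average_objective f xs <= average_objective f y) ->
  \sum_i gradient (f i) xs = 0.
Proof.
move=> n0 L0 fs xsmin; set g := \sum_i _; apply: dot_eq0.
have n0' : 0 < n%:R :> R by rewrite ltr0n.
pose c : R := (n%:R * L)^-1; have nL0 : 0 < n%:R * L by rewrite mulr_gt0.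
have := xsmin (xs + - c *: g); rewrite /average_objective ler_pM2l ?invr_gt0//.
have le_sum : \sum_i f i (xs + - c *: g) <= \sum_i (f i xs
    + dot (gradient (f i) xs) (- c *: g) + L / 2 * dot (- c *: g) (- c *: g)).
  by apply: ler_sum => i _; exact: descent_le.
move=> /le_trans/(_ le_sum); rewrite !big_split /= sumr_const card_ord.
have -> : \sum_i dot (gradient (f i) xs) (- c *: g) = - c * dot g g.
  under eq_bigr do rewrite dotC.
  by rewrite -dot_sumr -/g dotZl.
rewrite dotZl dotZr -addrA lerDl -[X in _ + X]mulr_natl.
have -> : n%:R * (L / 2 * (- c * (- c * dot g g))) = c / 2 * dot g g.
  by rewrite /c; field; rewrite !gt_eqF.
have c0 : 0 < c by rewrite invr_gt0.
move=> h; have : c * dot g g <= 0 by lra.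
by rewrite pmulr_rle0// => h'; apply/le_anti; rewrite h' dot_ge0.
Qed.

(** Row by row, this is cocoercivity of each gradient. *)
Lemma stacked_gradient_cocoercive f L (X Y : 'M[R]_(n, p)) : 0 < L ->
  (forall i, convex_smooth (f i) L) ->
  L^-1 * dot (stacked_gradient f X - stacked_gradient f Y)
             (stacked_gradient f X - stacked_gradient f Y)
  <= dot (X - Y) (stacked_gradient f X - stacked_gradient f Y).
Proof.
move=> L0 fs; rewrite !(dot_rows (_ - _)) mulr_sumr; apply: ler_sum => i _.
by rewrite !linearB /= !rowK; exact: gradient_cocoercive.
Qed.

(** With H = (I + W)/2 - Wt, e' = x' - xs, d = x - x' and D the difference of
    the gradients at x and xs, the closed form centred at the fixed point reads
      Wt d = 2 H e' + U (q' - qs) + alpha D.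
    Pairing it with e', where U e' = U x' = q' - q, turns the cross terms into
    differences of squared distances. What is left is <e', H e'> >= 0 and
    <e', D> = <x - xs, D> - <d, D>, where cocoercivity of the gradient
    dominates the second term up to (L / 4) |d|^2. *)
Lemma extra_energy_step f W Wt U alpha L (x q x' xs qs : 'M[R]_(n, p)) :
  0 < alpha -> 0 < L -> (forall i, convex_smooth (f i) L) ->
  symmetric_mx Wt -> symmetric_mx U -> U *m U = Wt - W ->
  psd (2^-1 *: (1%:M + W) - Wt) ->
  U *m xs = 0 -> Wt *m xs = xs ->
  U *m qs + alpha *: stacked_gradient f xs = 0 ->
  x' = Wt *m x - U *m q - alpha *: stacked_gradient f x ->
  let energy (y r : 'M[R]_(n, p)) :=
    dot (r - qs) (r - qs) + dot (y - xs) (Wt *m (y - xs)) in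
  energy x' (q + U *m x') + dot (U *m x') (U *m x')
    + dot (x - x') (Wt *m (x - x'))
  <= energy x q + alpha * L / 2 * dot (x - x') (x - x').
Proof.
move=> alpha0 L0 fs Wts Us UU Hpsd Uxs Wtxs qsE x'E /=.
set H := 2^-1 *: _ - _ in Hpsd.
have [D DE] : {D | D = stacked_gradient f x - stacked_gradient f xs} by eexists.
have [e' e'E] : {e' | e' = x' - xs} by eexists.
have [w wE] : {w | w = U *m x'} by eexists.
have [d dE] : {d | d = x - x'} by eexists.
rewrite -e'E -wE -dE.
have Wxs : W *m xs = xs.
  have : U *m U *m xs = 0 by rewrite -mulmxA Uxs mulmx0.
  by rewrite UU mulmxBl Wtxs => /eqP; rewrite subr_eq0 => /eqP.
have kkt : Wt *m d = 2 *: (H *m e') + U *m (q + w - qs) + alpha *: D.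
  have HE v : 2 *: (H *m v) = v + W *m v - 2 *: (Wt *m v).
    rewrite /H mulmxBl -scalemxAl mulmxDl mul1mx scalerBr scalerA.
    by rewrite mulfV ?pnatr_eq0// scale1r.
  rewrite HE e'E wE dE DE !(mulmxBr, mulmxDr) mulmxA UU mulmxBl Wxs Wtxs.
  have -> : U *m qs = - (alpha *: stacked_gradient f xs).
    by apply/eqP; rewrite -addr_eq0 qsE.
  have -> : U *m q = Wt *m x - alpha *: stacked_gradient f x - x'.
    rewrite x'E; move: (U *m _) (Wt *m _) (alpha *: _) => a b c.
    by apply/matrixP => i j; rewrite !mxE; ring.
  rewrite scalerBr.
  move: (W *m _) (Wt *m x) (Wt *m x') (stacked_gradient f xs)
    (stacked_gradient f x).
  by move=> *; apply/matrixP => i j; rewrite !mxE; ring.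
have Ue' : U *m e' = w by rewrite e'E mulmxBr Uxs subr0 wE.
have key : dot e' (Wt *m d)
    = 2 * dot e' (H *m e') + dot w (q + w - qs) + alpha * dot e' D.
  rewrite kkt 2!(dotDr e') (dotZr 2) (dotZr alpha).
  by rewrite (dot_mulr _ U) Us Ue'.
have He' := psd_dot_ge0 e' Hpsd.
have coco := stacked_gradient_cocoercive x xs L0 fs.
rewrite -DE in coco.
have L2 : 0 < L / 2 by rewrite divr_gt0.
(* The weight L / 2 makes |D|^2 cancel against the cocoercivity bound. *)
have := dot_young d D L2; rewrite invf_div.
have -> : 2 / L * dot D D = 2 * (L^-1 * dot D D) by rewrite mulrA.
move=> young.
have eE : x - xs = e' + d by rewrite e'E dE [RHS]addrC addrA subrK.
have qE : q + w - qs = w + (q - qs) by rewrite (addrC q) addrA.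
have gradient_term : - (L / 4) * dot d d <= dot e' D.
  move: coco; rewrite eE dotDl; lra.
have := ler_wpM2l (ltW alpha0) gradient_term.
have [r rE] : {r | r = q - qs} by eexists.
rewrite -rE in qE *; rewrite qE in key; rewrite eE qE mulmxDr.
move: key; rewrite !(dotDl, dotDr) (psd_dot_sym d e' Wts) (dotC r w) => key scaled.
lra.
Qed.


End Extra.

(** If U U v = 0 then |U v|^2 = <v, U U v> = 0. *)
Lemma psd_sqrt_null (R : realType) n (U A : 'M[R]_n) (v : 'cV[R]_n) :
  is_psd_sqrt A U -> U *m v = 0 <-> A *m v = 0.
Proof.
move=> [[Us _] UU]; rewrite -UU -mulmxA; split=> [->|UUv]; first exact: mulmx0.
by apply: dot_eq0; rewrite -{1}Us -dot_mulr UUv dot0r.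
Qed.

(** The dual part qs exists because grad f(xs) has zero column sums, hence is
    orthogonal to the kernel of U, the span of the all-ones vector. *)
Lemma extra_fixed_point_exists (R : realType) n p (f : 'I_n -> 'rV[R]_p -> R) L
    (W Wt U : 'M[R]_n) alpha : (0 < n)%N -> 0 < L ->
  (forall i, convex_smooth (f i) L) -> mixing_matrices W Wt ->
  is_psd_sqrt (Wt - W) U -> has_minimizer (average_objective f) ->
  exists xs qs : 'M[R]_(n, p), [/\ U *m xs = 0, Wt *m xs = xs &
    U *m qs + alpha *: stacked_gradient f xs = 0].
Proof.
move=> n0 L0 fs [_ [_ _ _ [kerW kerWt] _]] Usqrt [xs xsmin].
have Us : U^T = U by case: Usqrt => -[].
pose X : 'M[R]_(n, p) := const_mx 1 *m xs.
have rowX i : row i X = xs.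
  by apply/rowP => j; rewrite !mxE big_ord1 mxE mul1r.
have in_span : span_ones n (const_mx 1 : 'cV[R]_n) by exists 1; rewrite ?scale1r.
have ker1 : (Wt - W) *m (const_mx 1 : 'cV[R]_n) = 0.
  have : null_space (W - Wt) (const_mx 1) by rewrite kerW.
  by rewrite /null_space /= -(opprB Wt) mulNmx => /eqP; rewrite oppr_eq0 => /eqP.
have [C CE] : exists C, (stacked_gradient f X)^T = C *m U.
  apply: factor_null_space => v /(psd_sqrt_null _ Usqrt) Av.
  have : null_space (W - Wt) v by rewrite /null_space /= -(opprB Wt) mulNmx Av oppr0.
  rewrite kerW => -[c _ <-]; rewrite -scalemxAr.
  have -> : (stacked_gradient f X)^T *m (const_mx 1 : 'cV[R]_n) = 0; last exact: scaler0.
  have /matrixP gsum := sum_gradient_at_minimizer n0 L0 fs xsmin.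
  apply/colP => j; have := gsum 0 j; rewrite summxE !mxE => gsumj.
  rewrite -[RHS]gsumj; apply: eq_bigr => i _.
  by rewrite !mxE rowX mulr1.
exists X, (- alpha *: C^T); split.
- by rewrite mulmxA (psd_sqrt_null _ Usqrt).2// mul0mx.
- have : null_space (1%:M - Wt) (const_mx 1) by exact: kerWt.
  rewrite /null_space /= mulmxBl mul1mx => /eqP; rewrite subr_eq0 => /eqP Wt1.
  by rewrite mulmxA -Wt1.
- have -> : stacked_gradient f X = U *m C^T by rewrite -[LHS]trmxK CE trmx_mul Us.
  by rewrite -scalemxAr scaleNr addNr.
Qed.

(** Cocoercivity needs a positive constant; this one also covers the case where
    all the Lipschitz constants vanish and the step size is unrestricted. *)
Lemma common_smoothness (R : realType) n (L : 'I_n -> R) (alpha lambda : R) :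
  0 < alpha -> 0 < lambda ->
  (max_lipschitz L != 0 -> alpha < 2 * lambda / max_lipschitz L) ->
  exists L', [/\ 0 < L', forall i, L i <= L' & alpha * L' < 2 * lambda].
Proof.
move=> alpha0 lambda0 alpha_lt; have Lmax i : L i <= max_lipschitz L.
  exact: le_bigmax.
have Lmax0 : 0 <= max_lipschitz L by exact: bigmax_ge_id.
have [L0|Lneq0] := eqVneq (max_lipschitz L) 0.
  (* All the gradients are constant: any positive constant will do, if it is
     small enough for this step size. *)
  exists (lambda / alpha); split; first by rewrite divr_gt0.
    by move=> i; rewrite (le_trans (Lmax i))// L0 divr_ge0// ltW.
  by rewrite mulrC divfK ?gt_eqF//; lra.
have Lgt0 : 0 < max_lipschitz L by rewrite lt_neqAle eq_sym Lneq0.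
by exists (max_lipschitz L); split=> //; rewrite -ltr_pdivlMr//; exact: alpha_lt.
Qed.

(** The factor zeta = 1 - alpha L / (2 lambda) is positive by the step size
    condition: lambda |x^t - x^(t+1)|^2 is at most the progress, so the energy
    decreases by at least zeta times the progress at each step. *)
Lemma progress_summable (R : realType) n p (f : 'I_n -> 'rV[R]_p -> R) L
    (W Wt U : 'M[R]_n) (alpha lambda : R) (x : nat -> 'M[R]_(n, p)) :
  (0 < n)%N -> 0 < L -> (forall i, convex_smooth (f i) L) ->
  mixing_matrices W Wt -> is_psd_sqrt (Wt - W) U ->
  has_minimizer (average_objective f) ->
  0 < lambda -> psd (Wt - lambda%:M) ->
  0 < alpha -> alpha * L < 2 * lambda ->
  extra_iterates f W Wt alpha x ->
  exists M, forall k, \sum_(0 <= t < k) (dot (U *m x t.+1) (U *m x t.+1)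
    + dot (x t - x t.+1) (Wt *m (x t - x t.+1))) <= M.
Proof.
move=> n0 L0 fs mixing Usqrt solvable lambda0 Wtl alpha0 alphaL extra.
have [xs [qs [Uxs Wtxs qsE]]] :=
  extra_fixed_point_exists alpha n0 L0 fs mixing Usqrt solvable.
have [_ [_ _ [_ Wts] _ [Wtpd Hpsd _]]] := mixing.
have Wtpsd := pd_psd Wtpd.
have [[Us _] UU] := Usqrt.
pose E t := dot (q_seq U x t - qs) (q_seq U x t - qs)
  + dot (x t - xs) (Wt *m (x t - xs)).
pose zeta := 1 - alpha * L / (2 * lambda).
have zeta0 : 0 < zeta by rewrite subr_gt0 ltr_pdivrMr ?mul1r// mulr_gt0.
have E_ge0 t : 0 <= E t by rewrite addr_ge0 ?dot_ge0// psd_dot_ge0.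
pose P t := dot (U *m x t.+1) (U *m x t.+1)
  + dot (x t - x t.+1) (Wt *m (x t - x t.+1)).
have decrease t : zeta * P t <= E t - E t.+1.
  have := extra_energy_step alpha0 L0 fs Wts Us UU Hpsd Uxs Wtxs qsE
    (extra_closed_form t UU extra).
  rewrite /= -q_seqS -/(E t) -/(E t.+1) -addrA -/(P t) => step.
  have coercive := psd_subr_scalar_dot (x t - x t.+1) Wtl.
  have dP : dot (x t - x t.+1) (x t - x t.+1) <= P t / lambda.
    rewrite ler_pdivlMr// mulrC (le_trans coercive)// lerDr; exact: dot_ge0.
  have aL0 : 0 <= alpha * L / 2 by rewrite divr_ge0// mulr_ge0// ltW.
  have := ler_wpM2l aL0 dP.
  have -> : zeta * P t = P t - alpha * L / 2 * (P t / lambda).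
    by rewrite /zeta; field; rewrite gt_eqF.
  lra.
exists (E 0%N / zeta) => k; rewrite ler_pdivlMr// mulrC.
suff : zeta * \sum_(0 <= t < k) P t <= E 0%N - E k by have := E_ge0 k; lra.
elim: k => [|k IH]; first by rewrite big_geq// mulr0 subrr.
rewrite big_nat_recr//= mulrDr; have := decrease k; lra.
Qed.

(** I - Wt vanishes on the all-ones vector, hence on the kernel of U, so that
    I - Wt = C U and the residual is (x^t - x^(t+1)) - C (U x^t). *)
Lemma stationarity_bounded (R : realType) n p (f : 'I_n -> 'rV[R]_p -> R)
    (W Wt U : 'M[R]_n) (alpha lambda : R) :
  mixing_matrices W Wt -> is_psd_sqrt (Wt - W) U ->
  0 < lambda -> psd (Wt - lambda%:M) ->
  exists2 K, 0 < K & forall x : nat -> 'M[R]_(n, p),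
    extra_iterates f W Wt alpha x -> forall t,
    weighted_norm Wt (U *m q_seq U x t + alpha *: stacked_gradient f (x t)) ^+ 2
    <= K * (dot (U *m x t) (U *m x t)
            + dot (x t - x t.+1) (Wt *m (x t - x t.+1))).
Proof.
move=> [_ [_ _ _ [kerW kerWt] [Wtpd _ _]]] Usqrt lambda0 Wtl.
have [C CE] : exists C, 1%:M - Wt = C *m U.
  apply: factor_null_space => v /(psd_sqrt_null _ Usqrt) Av.
  have : null_space (W - Wt) v by rewrite /null_space /= -(opprB Wt) mulNmx Av oppr0.
  by rewrite kerW => /kerWt.
have [K1 K10 hK1] := dot_quad_bounded Wt.
have [K2 K20 hK2] := dot_mulmx_bounded C.
have li0 : 0 < lambda^-1 by rewrite invr_gt0.
exists (2 * K1 * (K2 + lambda^-1)) => [|x extra t].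
  by rewrite !mulr_gt0// addr_gt0.
rewrite (weighted_norm_sqr _ (pd_psd Wtpd)).
have [d dE] : {d | d = x t - x t.+1} by eexists.
have [u uE] : {u | u = U *m x t} by eexists.
rewrite -dE -uE.
have -> : U *m q_seq U x t + alpha *: stacked_gradient f (x t) = d - C *m u.
  rewrite uE mulmxA -CE mulmxBl mul1mx dE.
  case: Usqrt => _ UU; rewrite (extra_closed_form t UU extra).
  move: (U *m q_seq _ _ _) (Wt *m x t) (alpha *: _) => a b c.
  by apply/matrixP => i j; rewrite !mxE; ring.
apply: le_trans (hK1 _ _) _; rewrite (mulrC 2) -!mulrA ler_pM2l//.
have dW : dot d d <= lambda^-1 * dot d (Wt *m d).
  by rewrite ler_pdivlMl//; exact: psd_subr_scalar_dot.
have Wd0 := psd_dot_ge0 d (pd_psd Wtpd); have u0 := dot_ge0 u.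
have c1 : 0 <= K2 * dot d (Wt *m d) by rewrite mulr_ge0// ltW.
have c2 : 0 <= lambda^-1 * dot u u by rewrite mulr_ge0// ltW.
have := dot_ge0 (d + C *m u); have := hK2 _ u.
rewrite !(dotDl, dotDr, dotNl, dotNr) (dotC (C *m u) d); lra.
Qed.

Theorem theorem3p5 (R : realType) (n p : nat) (n_gt0 : (0 < n)%N)
    (p_gt0 : (0 < p)%N) (f : 'I_n -> 'rV[R]_p -> R) (L : 'I_n -> R)
    (W Wt U : 'M[R]_n) (alpha : R) (x : nat -> 'M[R]_(n, p))
    (mixing : mixing_matrices W Wt)
    (smooth : forall i, convex_smooth (f i) (L i))
    (solvable : has_minimizer (average_objective f))
    (alpha_gt0 : 0 < alpha)
    (alpha_lt : max_lipschitz L != 0 ->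
       alpha < 2 * lambda_min Wt / max_lipschitz L)
    (sqrtU : is_psd_sqrt (Wt - W) U)
    (extra : extra_iterates f W Wt alpha x) :
  let progress (t : nat) : R :=
    weighted_norm (G_mx Wt) (z_seq U x t - z_seq U x t.+1) ^+ 2 in
  let stationarity (t : nat) : R :=
    weighted_norm Wt (U *m q_seq U x t + alpha *: stacked_gradient f (x t))
      ^+ 2 in
  let consensus (t : nat) : R := frobenius_norm (U *m x t) ^+ 2 in
  let inv (k : nat) : R := k%:R^-1 in
  [/\ running_average progress =O_\oo inv,
      running_best progress =o_\oo inv,
      running_average stationarity =O_\oo inv /\
        running_average consensus =O_\oo inv &
      running_best stationarity =o_\oo inv /\
        running_best consensus =o_\oo inv].
Proof.
have [_ [_ _ _ _ [Wtpd _ _]]] := mixing; have Wtpsd := pd_psd Wtpd.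
have [lambda0 Wtl] := lambda_min_pd n_gt0 Wtpd.
have [L' [L0 LL' alphaL]] := common_smoothness alpha_gt0 lambda0 alpha_lt.
have fs i : convex_smooth (f i) L' by exact: convex_smooth_le (LL' i) (smooth i).
have [M sumM] := progress_summable n_gt0 L0 fs mixing sqrtU solvable lambda0 Wtl
  alpha_gt0 alphaL extra.
have [K K0 statK] := stationarity_bounded f alpha mixing sqrtU lambda0 Wtl.
move=> progress stationarity consensus inv.
have Wd0 t := psd_dot_ge0 (x t - x t.+1) Wtpsd.
have pE t : progress t = dot (U *m x t.+1) (U *m x t.+1)
    + dot (x t - x t.+1) (Wt *m (x t - x t.+1)) by exact: progressE.
have sum_progress k : \sum_(0 <= t < k) progress t <= M.
  by under eq_bigr do rewrite pE.
have progress_ge0 t : 0 <= progress t by exact: sqr_ge0.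
have u0 t := dot_ge0 (U *m x t).
have [pO po] : running_average progress =O_\oo inv /\
    running_best progress =o_\oo inv.
  apply: (rates_of_dominated progress_ge0 sum_progress ler01) => // t.
  by rewrite mul1r lerDr.
have [cO co] : running_average consensus =O_\oo inv /\
    running_best consensus =o_\oo inv.
  apply: (rates_of_dominated progress_ge0 sum_progress ler01) => [t|t].
    exact: sqr_ge0.
  rewrite mul1r /consensus frobenius_norm_sqr pE -addrA lerDl.
  by rewrite addr_ge0.
have [sO so] : running_average stationarity =O_\oo inv /\
    running_best stationarity =o_\oo inv.
  apply: (rates_of_dominated progress_ge0 sum_progress (ltW K0)) => [t|t].
    exact: sqr_ge0.
  apply: le_trans (statK _ extra t.+1) _; rewrite ler_pM2l// !pE.
  have := Wd0 t; have := u0 t.+2; lra.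
by split.
Qed.
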